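(* Every nonabelian finite simple group has Property $(P)$.
   Context: A finite group $G$ has Property $(P)$ if, for any two maximal subgroups $M_1, M_2 \leq G$ (possibly equal), there exists an element $g \in G$ of prime order such that $g \notin M_1 \cup M_2$. *)

(* Defs.v *)
From mathcomp Require Import all_boot all_fingroup all_solvable.

Set Implicit Arguments.
Unset Strict Implicit.
Unset Printing Implicit Defensive.

Definition property_P (gT : finGroupType) (G : {group gT}) : Prop :=
  forall M1 M2 : {group gT}, maximal M1 G -> maximal M2 G ->
  exists g : gT, [/\ g \in G, prime #[g]%g & g \notin M1 :|: M2].

(* Main.v *)
Require Import Defs.
From mathcomp Require Import all_boot all_fingroup all_solvable.

(** Let C be the conjugacy class of a nontrivial element and suppose it lies in
    the union of two proper subgroups M1 and M2. The set A of elements of C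
    outside M2 lies in M1. It is invariant under conjugation by every element of
    C in M2, since a conjugate of a in A stays in C and outside M2; and the
    elements of C outside M2 belong to A. So C normalises <A>, and by simplicity
    C generates G; hence <A> is a normal subgroup contained in M1, so A is empty
    and C lies in M2, which is absurd since C generates G. *)

Import GroupScope.

(** A class is stable under conjugation by [G], so it generates a normal subgroup, which is
    nontrivial because it contains [x]. *)
Lemma gen_class_simple (gT : finGroupType) (G : {group gT}) (x : gT) :
  simple G -> x \in G -> x != 1 -> <<x ^: G>> = G.
Proof.
case/simpleP=> _ simG Gx ntx.
have nCG: <<x ^: G>> <| G.
  by rewrite /normal gen_subG class_subG //= norms_gen // class_norm.
case: (simG _ nCG) => // C1; case/eqP: ntx.
by apply/set1gP; rewrite -C1 mem_gen // class_refl.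
Qed.

Lemma class_not_sub_setU (gT : finGroupType) (G M1 M2 : {group gT}) (x : gT) :
    simple G -> x \in G -> x != 1 -> M1 \proper G -> M2 \proper G ->
  ~~ (x ^: G \subset M1 :|: M2).
Proof.
move=> simG Gx ntx pM1 pM2; apply/negP=> sCM.
have genC := gen_class_simple _ _ _ simG Gx ntx.
have sCG: x ^: G \subset G by rewrite class_subG.
have C_not_sub (M : {group gT}) : M \proper G -> ~~ (x ^: G \subset M).
  by move=> pM; rewrite -gen_subG genC proper_subn.
pose A := x ^: G :\: M2.
have sAM1: A \subset M1.
  apply/subsetP=> a; rewrite inE => /andP[M2'a Ca].
  by move/(subsetP sCM): Ca; rewrite inE (negPf M2'a) orbF.
have nAC: x ^: G \subset 'N(<<A>>).
  apply/subsetP=> c Cc; have [M2c | M2'c] := boolP (c \in M2); last first.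
    by apply: (subsetP (normG <<A>>)); rewrite mem_gen // inE M2'c.
  apply: (subsetP (norm_gen A)); rewrite inE; apply/subsetP=> _ /imsetP[a Aa ->].
  move: Aa; rewrite !inE groupJr // => /andP[-> Ca] /=.
  by rewrite memJ_norm // (subsetP (class_norm x G)) // (subsetP sCG).
have nAG: <<A>> <| G.
  rewrite /normal gen_subG (subset_trans (subsetDl _ _) sCG) /=.
  by rewrite -{1}genC gen_subG.
case/simpleP: simG => _ /(_ _ nAG) [A1 | AG].
  case/negP: (C_not_sub M2 pM2); apply/subsetP=> c Cc.
  (* Triviality of [<<A>>] leaves only [c = 1], which is excluded because [1] lies in [M2]. *)
  apply: contraT => M2'c; have : c \in <<A>> by rewrite mem_gen // inE M2'c.
  by rewrite [<<A>>]A1 => /set1gP c1; rewrite c1 group1 in M2'c.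
by case/negP: (proper_subn pM1); rewrite -AG gen_subG.
Qed.

Theorem proposition1p2 (gT : finGroupType) (G : {group gT}) :
  simple G -> ~~ abelian G -> property_P G.
Proof.
move=> simG _ M1 M2 /maxgroupp pM1 /maxgroupp pM2.
have ntG: G :!=: 1 by case/simpleP: simG.
(* Conjugates share their order, so it is enough to start from some [x] of prime order and find a
   conjugate outside both subgroups. *)
have p_pr: prime (pdiv #|G|) by rewrite pdiv_prime // cardG_gt1.
have [x Gx ox] := Cauchy p_pr (pdiv_dvd #|G|).
have ntx: x != 1 by rewrite -order_gt1 ox prime_gt1.
have /subsetPn[g Cg M'g] :=
  class_not_sub_setU _ _ _ _ _ simG Gx ntx pM1 pM2.
exists g; split=> //; first by rewrite (subsetP (class_subG Gx (subxx G))).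
by case/imsetP: Cg => y _ ->; rewrite orderJ ox.
Qed.
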